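(* Let $f:\mathbb{R}^n\to\mathbb{R}$ be convex and continuously differentiable, with $|f(x)-f(y)|\le L_0\|x-y\|$ and $\|\nabla f(x)-\nabla f(y)\|\le L_1\|x-y\|$ for all $x,y$. Let the noisy objective be $\tilde f(x;\xi)=f(x)[1+\nu(x;\xi)]$, where $\nu$ is i.i.d. with $\mathbb{E}[\nu]=0$ and variance $\sigma_r^2=\mathrm{Var}(\nu)>0$, $\mathbb{E}[\frac{1}{1+\nu}]\le b$, and the support of $\nu$ is contained in $[-a,a]$ for some $a<1$. Let $u\in\mathbb{R}^n$ be a standard Gaussian vector and $u,\xi_1,\xi_2$ independent, and for $\mu>0$ define $$\mathcal{E}(\mu)=\left\|\frac{\tilde f(x+\mu u;\xi_1)-\tilde f(x;\xi_2)}{\mu}u-\langle\nabla f(x),u\rangle u\right\|^2 .$$ Let $x\in\mathbb{R}^n$ with $f(x)\ne0$, and choose $$\mu^*=C_4\sqrt{|f(x)|},\qquad C_4=\left[\frac{16\sigma_r^2 n}{L_1^2(1+3\sigma_r^2)(n+6)^3}\right]^{1/4}.$$ Then $$\mathbb{E}_{u,\xi_1,\xi_2}[\mathcal{E}(\mu^* )]\le 2L_1\sigma_r\sqrt{(1+3\sigma_r^2)n(n+6)^3}\,|f(x)|+3L_0^2\sigma_r^2(n+4)^2.$$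
   Context: $\|\cdot\|$ is the Euclidean norm, $\langle\cdot,\cdot\rangle$ the Euclidean inner product; ''standard Gaussian'' means mean $0$ and covariance $I_n$. The noise values in the two evaluations are independent copies of $\nu$. *)

(* Defs.v *)
From HB Require Import structures.
From mathcomp Require Import all_boot all_order all_algebra.
From mathcomp Require Import all_classical all_reals all_analysis.
Set Implicit Arguments. Unset Strict Implicit. Unset Printing Implicit Defensive.
Import Order.TTheory GRing.Theory Num.Theory.
Import numFieldNormedType.Exports.
Local Open Scope classical_set_scope.
Local Open Scope ring_scope.

Section defs.
Variables (R : realType) (n : nat).

Definition dotv (x y : 'rV[R]_n) : R := \sum_(i < n) x 0 i * y 0 i.
Definition enorm (x : 'rV[R]_n) : R := Num.sqrt (dotv x x).

Definition ebasis (i : 'I_n) : 'rV[R]_n := delta_mx 0 i.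

Definition grad (f : 'rV[R]_n -> R) (x : 'rV[R]_n) : 'rV[R]_n :=
  \row_i ('D_(ebasis i) f x).

Definition convex_fun (f : 'rV[R]_n -> R) : Prop :=
  forall (x y : 'rV[R]_n) (t : R), 0 <= t <= 1 ->
    f ((1 - t) *: x + t *: y) <= (1 - t) * f x + t * f y.

Definition C1_fun (f : 'rV[R]_n -> R) : Prop :=
  (forall x, differentiable f x) /\ continuous (grad f).
End defs.

Definition mutually_independent {d} {Omega : measurableType d} {R : realType}
  (P : probability Omega R) (I : finType) (X : I -> Omega -> R) : Prop :=
  forall B : I -> set R, (forall i, measurable (B i)) ->
    P (\bigcap_(i in [set: I]) (X i @^-1` B i)) =
    (\prod_(i : I) P (X i @^-1` B i))%E.

Definition noisy {R : realType} {n : nat} (f : 'rV[R]_n -> R) (y : 'rV[R]_n)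
  (nu : R) : R := f y * (1 + nu).

Definition err {R : realType} {n : nat} (f : 'rV[R]_n -> R) (x : 'rV[R]_n)
  (mu : R) (u : 'rV[R]_n) (nu1 nu2 : R) : R :=
  enorm ((((noisy f (x + mu *: u) nu1 - noisy f x nu2) / mu) *: u)
         - (dotv (grad f x) u) *: u) ^+ 2.

Definition C4 {R : realType} (n : nat) (L1 sr : R) : R :=
  ((16 * sr ^+ 2 * n%:R) / (L1 ^+ 2 * (1 + 3 * sr ^+ 2) * (n%:R + 6) ^+ 3))
    `^ (4%:R^-1).

(* Main.v *)
(* Fix the Gaussian vector u and the second noise value and average over the
   first one, then average over the second: the cross terms vanish, and with
   F = f(x + mu u), S = |u|^2, D = <grad f(x), u> and the Taylor remainder
   r = (F - f(x)) / mu - D what is left is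
     S (r^2 + sr^2 f(x)^2 / mu^2 + sr^2 F^2 / mu^2).
   Now |r| <= L1 mu S / 2, D^2 <= L0^2 S and F = f(x) + mu D + mu r, so this is
   at most a polynomial in S; the bounds n, n (n + 2), n (n + 2) (n + 4) on the
   first three moments of S conclude, since mu = C4 sqrt |f(x)| makes the two
   terms that depend on mu equal. *)
Require Import Defs.
From HB Require Import structures.
From mathcomp Require Import all_boot all_order all_algebra.
From mathcomp Require Import all_classical all_reals all_analysis.
From mathcomp Require Import measurable_realfun ring lra.
Set Implicit Arguments.
Unset Strict Implicit.
Unset Printing Implicit Defensive.
Import Order.TTheory GRing.Theory Num.Theory.
Import numFieldNormedType.Exports.
Local Open Scope classical_set_scope.
Local Open Scope ring_scope.

(** Fixing all variables but one is a single device used twice: for the two noise values, and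
    coordinate by coordinate for the moments of [S]. Conditioning is replaced by Tonelli. Let
    [Omega] carry the coarser sigma-algebra generated by the variables other than [X k]; then [X k]
    and the identity of [Omega] are independent, and the joint integral becomes an iterated one in
    which the point [w] stays frozen. Since the integrands are nonnegative, upper bounds on extended
    integrals can be added and chained freely; in the averaging, integrability matters only where a
    linear term of mean zero has to vanish. For the same reason the Gaussian moments are needed only
    as upper bounds. *)

(** * Independence and iterated integrals *)

(** The law of the pair agrees with the product of the laws on rectangles, hence everywhere, and
    Tonelli applies. The target spaces are arbitrary so that [Y] may be an identity map onto a
    coarser sigma-algebra. *)
Lemma integral_indep (R : realType) d d1 d2 (T : measurableType d)
  (T1 : measurableType d1) (T2 : measurableType d2) (P : probability T R)
  (X : T -> T1) (Y : T -> T2) (h : T1 * T2 -> \bar R) :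
  measurable_fun setT X -> measurable_fun setT Y ->
  (forall A B, measurable A -> measurable B ->
     P (X @^-1` A `&` Y @^-1` B) = (P (X @^-1` A) * P (Y @^-1` B))%E) ->
  measurable_fun setT h -> (forall z, 0 <= h z)%E ->
  (\int[P]_w h (X w, Y w) = \int[P]_w \int[P]_v h (X v, Y w))%E.
Proof.
move=> mX mY XY mh h0.
pose Xm : {mfun T >-> T1} := HB.pack X (isMeasurableFun.Build _ _ _ _ _ mX).
pose Ym : {mfun T >-> T2} := HB.pack Y (isMeasurableFun.Build _ _ _ _ Y mY).
have mZ : measurable_fun setT (fun w => (X w, Y w)).
  exact: measurable_fun_pair.
pose Zm : {mfun T >-> (T1 * T2)%type} :=
  HB.pack (fun w => (X w, Y w)) (isMeasurableFun.Build _ _ _ _ _ mZ).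
have lawZ A : measurable A ->
    (distribution P Xm \x distribution P Ym)%E A = distribution P Zm A.
  move: A; apply: product_measure_unique => B C mB mC.
  by rewrite /distribution/= /pushforward -XY.
have -> : (\int[P]_w h (X w, Y w) = \int[distribution P Zm]_z h z)%E.
  by rewrite /distribution ge0_integral_pushforward.
transitivity (\int[(distribution P Xm \x distribution P Ym)%E]_z h z)%E.
  by apply: eq_measure_integral => A mA _; apply/esym/lawZ.
rewrite fubini_tonelli2// /distribution ge0_integral_pushforward//=;
    last 2 first.
- exact: measurable_fun_fubini_tonelli_G.
- by move=> y _; apply: integral_ge0.
rewrite preimage_setT; apply: eq_integral => w _ /=.
rewrite /fubini_G ge0_integral_pushforward//.
exact: measurableT_comp mh (measurable_pair2 _).
Qed.

Section mutual_independence.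
Context d (Omega : measurableType d) (R : realType) (P : probability Omega R).
Context (I : finType) (X : I -> Omega -> R).
Hypothesis mX : forall i, measurable_fun setT (X i).
Hypothesis indepX : mutually_independent P X.

(* Generates the sigma-algebra of the [X i] with [i != k]. *)
Definition cylinder (k : I) : set (set Omega) :=
  [set C | exists2 B : I -> set R, (forall i, measurable (B i)) &
     C = \bigcap_(i in [set i | i != k]) X i @^-1` B i].

Lemma cylinder_measurable k : cylinder k `<=` measurable.
Proof.
move=> _ [B mB ->]; apply: fin_bigcap_measurable => [|i _].
  exact: finite_finset.
by rewrite -[X in measurable X]setTI; exact: mX.
Qed.

Lemma sigma_cylinder_measurable k : <<s cylinder k >> `<=` measurable.
Proof.
apply: smallest_sub; last exact: cylinder_measurable.
exact: sigma_algebra_measurable.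
Qed.

(** Mutual independence is applied twice, with [A] and with the full line at index [k]; the second
    use identifies the remaining product as [P C]. *)
Lemma cylinder_indep k (A : set R) (C : set Omega) :
  measurable A -> cylinder k C -> P (X k @^-1` A `&` C) =
  (P (X k @^-1` A) * P C)%E.
Proof.
move=> mA [B mB ->].
pose B' A' i := if i == k then A' else B i.
have mB' A' : measurable A' -> forall i, measurable (B' A' i).
  by move=> mA' i; rewrite /B'; case: ifP.
have E A' : \bigcap_(i in [set: I]) X i @^-1` B' A' i =
    X k @^-1` A' `&` \bigcap_(i in [set i | i != k]) X i @^-1` B i.
  apply/seteqP; split => [w h|w [hk h] i _].
    split; first by have := h k Logic.I; rewrite /B' eqxx.
    by move=> i /= /negbTE ik; have := h i Logic.I; rewrite /B' ik.
  by rewrite /B'; case: eqP => [->//|/eqP ik]; exact: h.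
have F A' : measurable A' ->
    P (X k @^-1` A' `&` \bigcap_(i in [set i | i != k]) X i @^-1` B i) =
    (P (X k @^-1` A') * \prod_(i | i != k) P (X i @^-1` B i))%E.
  move=> mA'; rewrite -E indepX; last exact: mB'.
  rewrite (bigD1 k)//= {1}/B' eqxx; congr (_ * _)%E.
  by apply: eq_bigr => i /negbTE ik; rewrite /B' ik.
rewrite F//; congr (_ * _)%E.
have := F _ measurableT.
by rewrite preimage_setT setTI probability_setT mul1e.
Qed.

(** Cylinders form a pi-system containing the whole space, so two finite measures that agree on them
    agree on the generated sigma-algebra. *)
Lemma sigma_cylinder_indep k (A : set R) (C : set Omega) :
  measurable A -> <<s cylinder k >> C -> P (X k @^-1` A `&` C) =
  (P (X k @^-1` A) * P C)%E.
Proof.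
move=> mA; have mXA : measurable (X k @^-1` A).
  by rewrite -[X in measurable X]setTI; exact: mX.
have pA : (0 <= fine (P (X k @^-1` A)))%R by exact: fine_ge0.
move=> sC; rewrite setIC -[X in (X * _)%E]fineK; last exact: fin_num_measure.
(* In the variable [C], both sides are measures: [P] restricted to the event on [X k], and [P]
   scaled by the probability of that event. *)
apply: (g_sigma_algebra_measure_unique _ (@cylinder_measurable k)
  (fun _ => setT) _ _ (mrestr P mXA) (mscale (NngNum pA) P)) sC.
- move=> _; exists (fun _ => setT) => //.
  by apply/seteqP; split.
- by apply/seteqP; split => // w _; exists 0%N.
- move=> _ _ [B mB ->] [B' mB' ->]; exists (fun i => B i `&` B' i).
    by move=> i; exact: measurableI.
  by rewrite -bigcapI; apply: eq_bigcapr => i _; rewrite preimage_setI.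
- move=> D cD; rewrite /= /mrestr /mscale/= setIC cylinder_indep// fineK//.
  exact: fin_num_measure.
- move=> _; rewrite /= /mrestr setTI.
  apply: le_lt_trans (probability_le1 _ _) _ => //.
  exact: ltry.
Qed.

Lemma measurable_cylinder k i : i != k ->
  measurable_fun setT (X i : g_sigma_algebraType (cylinder k) -> R).
Proof.
move=> ik _ B mB; rewrite setTI; apply: sub_sigma_algebra.
exists (fun j => if j == i then B else setT); first by move=> j; case: ifP.
apply/seteqP; split => [w h j _|w /(_ i ik)]; last by rewrite eqxx.
by case: eqP => [->|].
Qed.

(** Measurability of [h] in its second argument, for the coarse sigma-algebra, expresses that [h]
    sees [w] only through the variables other than [X k]. *)
Lemma integral_freeze k (h : R * g_sigma_algebraType (cylinder k) -> \bar R) :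
  measurable_fun setT h -> (forall z, 0 <= h z)%E ->
  (\int[P]_w h (X k w, w) = \int[P]_w \int[P]_v h (X k v, w))%E.
Proof.
move=> mh h0.
apply: (@integral_indep _ _ _ _ _ _ _ P (X k)
  (id : Omega -> g_sigma_algebraType (cylinder k))) => //.
- by move=> _ B sB; rewrite setTI; exact: (@sigma_cylinder_measurable k).
- by move=> A B mA sB; exact: sigma_cylinder_indep.
Qed.

End mutual_independence.

(** * Integration against a measure with a density *)

Section density.
Context d (T : measurableType d) (R : realType).
Context (mu nu : {measure set T -> \bar R}) (g : T -> R).
Hypothesis mg : measurable_fun setT g.
Hypothesis g0 : forall x, 0 <= g x.
Hypothesis nuE : forall A, measurable A -> (nu A = \int[mu]_(x in A) (g x)%:E)%E.
Import HBNNSimple.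

Lemma integral_density_indic A : measurable A ->
  (\int[nu]_x (\1_A x)%:E = \int[mu]_x ((\1_A x)%:E * (g x)%:E))%E.
Proof.
move=> mA; rewrite integral_indic// setIT nuE// integral_mkcond.
apply: eq_integral => x _; rewrite patchE indicE.
by case: ifP => xA /=; rewrite ?mul1e ?mul0e.
Qed.

Lemma integral_density_nnsfun (h : {nnsfun T >-> R}) :
  (\int[nu]_x (h x)%:E = \int[mu]_x ((h x)%:E * (g x)%:E))%E.
Proof.
under [LHS]eq_integral do rewrite fimfunE -fsumEFin//.
rewrite [LHS]ge0_integral_fsum//; last 2 first.
  - by move=> r; exact/measurable_EFinP/measurableT_comp.
  - by move=> n x _; rewrite EFinM nnfun_muleindic_ge0.
under [RHS]eq_integral.
  move=> x xD; rewrite fimfunE -fsumEFin// muleC ge0_mule_fsumr; last first.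
    by move=> r; rewrite EFinM nnfun_muleindic_ge0.
  over.
rewrite [RHS]ge0_integral_fsum//; last 2 first.
  - move=> r; apply: emeasurable_funM; first exact/measurable_EFinP.
    by apply/measurable_EFinP; apply/measurableT_comp => //.
  - move=> n x _; rewrite mule_ge0//; first by rewrite lee_fin.
    by rewrite EFinM nnfun_muleindic_ge0.
apply: eq_fsbigr => r _.
(* A nonnegative simple function never takes a negative value [r], so that term is zero on both
   sides. *)
have [r0|r0] := leP 0 r; last first.
  have z x : r * \1_(h @^-1` [set r]) x = 0.
    by rewrite preimage_nnfun0// indicE in_set0 mulr0.
  transitivity (0%R : \bar R); [|apply/esym];
    by apply: integral0_eq => x _; rewrite z ?mule0.
under [LHS]eq_integral do rewrite EFinM.
rewrite ge0_integralZl//; last exact/measurable_EFinP.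
rewrite integral_density_indic// -ge0_integralZl//; last 2 first.
- apply: emeasurable_funM; last exact/measurable_EFinP.
  by apply/measurable_EFinP.
- by move=> x _; rewrite mule_ge0 ?lee_fin.
by apply: eq_integral => x _; rewrite EFinM [RHS]muleC -muleA.
Qed.

(** Simple functions increase to [h], and monotone convergence passes to the limit under both
    measures. *)
Lemma ge0_integral_density (h : T -> \bar R) :
  measurable_fun setT h -> (forall x, 0 <= h x)%E ->
  (\int[nu]_x h x = \int[mu]_x (h x * (g x)%:E))%E.
Proof.
move=> mh h0; pose h_ := nnsfun_approx measurableT mh.
have hE x : h x = (lim ((h_ n x)%:E @[n --> \oo]))%E.
  by apply/esym/cvg_lim => //=; exact: cvg_nnsfun_approx.
have nd_h x m n : (m <= n)%N -> ((h_ m x)%:E <= (h_ n x)%:E)%E.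
  by move=> mn; rewrite lee_fin; exact/lefP/nd_nnsfun_approx.
transitivity (lim (\int[nu]_x (h_ n x)%:E @[n --> \oo])%E).
  rewrite -monotone_convergence//=.
  - by apply: eq_integral => x _.
  - by move=> n; exact/measurable_EFinP/measurable_funTS.
  - by move=> n ? _; rewrite lee_fin.
  - by move=> x _ m n; exact: nd_h.
under [in LHS]eq_fun do rewrite integral_density_nnsfun.
rewrite -monotone_convergence//=.
- apply: eq_integral => x _; apply/cvg_lim => //=.
  apply: cvgeZr => //.
  exact: cvg_nnsfun_approx.
- move=> n; apply: emeasurable_funM; last exact/measurable_EFinP.
  exact/measurable_EFinP/measurable_funTS.
- by move=> n ? _; rewrite mule_ge0 ?lee_fin.
- by move=> x _ m n mn; apply: lee_wpmul2r; [rewrite lee_fin|exact: nd_h].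
Qed.
End density.

(** * Even moments of the standard normal law *)

Section gaussian_moments.
Context (R : realType).
Local Notation mu := (@lebesgue_measure R).
Local Notation phi := (@normal_pdf R 0 1).

Lemma is_derive_std_normal_pdf (z : R) : is_derive z 1 phi (- z * phi z).
Proof.
rewrite normal_pdfE ?oner_eq0//.
pose q : R -> R := (- 2^-1) *: (fun z => z ^+ 2).
have fE y : normal_fun 0 1 y = expR (q y).
  rewrite /normal_fun /q /= subr0 expr1n; congr expR.
  by rewrite -[RHS]/(- 2^-1 * y ^+ 2); field.
have -> : (fun z : R => normal_peak 1 * normal_fun 0 1 z) =
    normal_peak 1 *: (expR \o q) by apply/funext => y; rewrite fE.
have dq : is_derive z 1 q (- z).
  by apply: is_derive_eq; rewrite -[LHS]/(- 2^-1 * _) /GRing.scale/=; field.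
have dc := is_derive1_comp (f := expR) (g := q) (x := z) _ dq.
apply: is_derive_eq.
by rewrite fE /GRing.scale/=; ring.
Qed.

(** Integrate by parts with [z * phi z] as the derivative of [- phi]. The odd power makes both
    boundary contributions nonpositive; dropping them turns the moment recursion into an
    inequality. *)
Lemma truncated_moment_le (k : nat) (a : R) : 0 < a ->
  (\int[mu]_(z in `[(- a)%R, a]) (z ^+ k.*2.+2 * phi z)%:E <=
   k.*2.+1%:R%:E * \int[mu]_(z in `[(- a)%R, a]) (z ^+ k.*2 * phi z)%:E)%E.
Proof.
move=> a0.
have dF (z : R) : is_derive z 1 (fun z : R => z ^+ k.*2.+1)
    (k.*2.+1%:R * z ^+ k.*2).
  have h : is_derive z 1 ((id : R -> R) ^+ k.*2.+1) (k.*2.+1%:R * z ^+ k.*2).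
    by apply: is_derive_eq; rewrite /GRing.scale/= mulr1.
  by move: h; rewrite exprfctE.
have dG (z : R) : is_derive z 1 (- phi) (z * phi z).
  have := is_derive_std_normal_pdf z => ?.
  by apply: is_derive_eq; rewrite mulNr opprK.
have LR (F f : R -> R) : (forall z : R, is_derive z 1 F (f z)) ->
    derivable_oo_LRcontinuous F (- a) a.
  move=> h; have cF : continuous F.
    move=> z; apply/differentiable_continuous/derivable1_diffP.
    by have [] := h z.
  split; first by move=> z _; have [] := h z.
  - exact/cvg_at_right_filter/cF.
  - exact/cvg_at_left_filter/cF.
have cphi : continuous phi by apply: continuous_normal_pdf; rewrite oner_eq0.
have cX m : continuous (fun z : R => z ^+ m) by exact: exprn_continuous.
have := @integration_by_parts R (fun z => z ^+ k.*2.+1) (- phi)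
  (fun z => k.*2.+1%:R * z ^+ k.*2) (fun z => z * phi z) (- a) a.
rewrite -subr_gt0 opprK addr_gt0// => /(_ isT) IBP.
under eq_integral do rewrite exprSr -mulrA.
rewrite IBP; last 6 first.
- by apply: continuous_subspaceT => z; apply: cvgM; [exact: cvg_cst|exact: cX].
- exact: LR dF.
- by move=> z _; rewrite derive1E; have [_ ->] := dF z.
- by apply: continuous_subspaceT => z; apply: cvgM; [exact: cvg_id|exact: cphi].
- exact: LR dG.
- by move=> z _; rewrite derive1E; have [_ ->] := dG z.
have -> : (\int[mu]_(z in `[(- a)%R, a])
      (k.*2.+1%:R * z ^+ k.*2 * (- phi) z)%:E =
    - (k.*2.+1%:R%:E * \int[mu]_(z in `[(- a)%R, a]) (z ^+ k.*2 * phi z)%:E))%E.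
  rewrite -mulNe -EFinN -integralZl//; last first.
    apply: continuous_compact_integrable; first exact: segment_compact.
    by apply: continuous_subspaceT => z; apply: cvgM; [exact: cX|exact: cphi].
  by apply: eq_integral => z _; rewrite -EFinM /=; congr EFin;
    rewrite -[(- phi) z]/(- phi z); ring.
rewrite oppeK -[leRHS]add0e leeD2r// lee_fin.
rewrite -[(- phi) _]/(- phi a) -[(- phi) _]/(- phi (- a)).
have -> : (- a) ^+ k.*2.+1 = - a ^+ k.*2.+1.
  by rewrite exprNn -signr_odd /= odd_double expr1 mulN1r.
have p1 : 0 <= a ^+ k.*2.+1 * phi a.
  by rewrite mulr_ge0 ?exprn_ge0 ?normal_pdf_ge0// ltW.
have p2 : 0 <= a ^+ k.*2.+1 * phi (- a).
  by rewrite mulr_ge0 ?exprn_ge0 ?normal_pdf_ge0// ltW.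
lra.
Qed.

Lemma normal_moment_le (k : nat) :
  (\int[@normal_prob R 0 1]_z (z ^+ k.*2.+2)%:E <=
   k.*2.+1%:R%:E * \int[@normal_prob R 0 1]_z (z ^+ k.*2)%:E)%E.
Proof.
have mphi : measurable_fun setT phi by exact: measurable_normal_pdf.
have mX m : measurable_fun setT (fun z : R => (z ^+ m)%:E).
  exact/measurable_EFinP/measurable_funX.
have ge0 m : forall z : R, (0 <= (z ^+ m.*2)%:E)%E.
  by move=> z; rewrite lee_fin exprn_even_ge0 ?odd_double.
have dens m : (\int[@normal_prob R 0 1]_z (z ^+ m.*2)%:E =
    \int[mu]_z (z ^+ m.*2 * phi z)%:E)%E.
  rewrite (@ge0_integral_density _ _ R mu (@normal_prob R 0 1) phi)//.
    exact: normal_pdf_ge0.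
  exact: mX.
rewrite -doubleS !dens.
have mXphi m : measurable_fun setT (fun z : R => (z ^+ m * phi z)%:E).
  by apply/measurable_EFinP; apply: measurable_funM => //; exact: measurable_funX.
have Xphi0 m z : (0 <= (z ^+ m.*2 * phi z)%:E)%E.
  by rewrite lee_fin mulr_ge0 ?exprn_even_ge0 ?odd_double ?normal_pdf_ge0.
(* The half-width is [i.+1], so that it is positive already for [i = 0]. *)
pose F (i : nat) : set R := `[(- i.+1%:R)%R, i.+1%:R]%classic.
have UF : \bigcup_i F i = setT.
  apply/seteqP; split => // z _; exists (Num.trunc `|z|) => //=.
  by rewrite /F/= in_itv/= -ler_norml ltW// truncnS_gt.
have ndF : nondecreasing_seq F.
  move=> i j ij; apply/subsetPset => z; rewrite /F /= !in_itv/= -!ler_norml.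
  move=> h.
  by apply: le_trans h _; rewrite ler_nat.
have := @ge0_nondecreasing_set_cvg_integral _ (measurableTypeR R) R F
  (fun z : R => (z ^+ k.+1.*2 * phi z)%:E) mu ndF.
rewrite UF => cvgF.
have {}cvgF : (\int[mu]_(z in F i) (z ^+ k.+1.*2 * phi z)%:E @[i --> \oo] -->
    \int[mu]_z (z ^+ k.+1.*2 * phi z)%:E)%E.
  apply: cvgF => // i; first exact: measurable_itv.
  exact: (@measurable_funTS _ _ (measurableTypeR R) _ _ _ (mXphi k.+1.*2)).
rewrite -(cvg_lim _ cvgF)//.
apply: lime_le; first by apply/cvg_ex; eexists; exact: cvgF.
(* Only the left side needs a limit: on the right, the truncated integral is at most the full
   one. *)
near=> i; apply: le_trans (@truncated_moment_le k i.+1%:R _) _.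
  by rewrite ltr0n.
apply: lee_pmul => //; first by apply: integral_ge0 => z _.
apply: (@ge0_subset_integral _ (measurableTypeR R)) => //.
  exact: mXphi.
Unshelve. all: by end_near.
Qed.

Context d (Omega : measurableType d) (P : probability Omega R).
Variable X : Omega -> R.
Hypothesis mX : measurable_fun setT X.
Hypothesis lawX :
  forall B : set R, measurable B -> P (X @^-1` B) = normal_prob 0 1 B.

(** The recursion factors 1, 3, 5 start from total mass 1, whence 1, 3 and 15 = 5 * 3. *)
Lemma std_normal_moments :
  [/\ \int[P]_w (X w ^+ 2)%:E <= 1, \int[P]_w (X w ^+ 4)%:E <= 3%:E
    & \int[P]_w (X w ^+ 6)%:E <= 15%:E]%E.
Proof.
have E k : (\int[P]_w (X w ^+ k.*2)%:E =
    \int[@normal_prob R 0 1]_z (z ^+ k.*2)%:E)%E.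
  have mX' : measurable_fun setT (X : Omega -> measurableTypeR R) by exact: mX.
  pose Y : {mfun Omega >-> measurableTypeR R} :=
    HB.pack X (isMeasurableFun.Build _ _ _ _ _ mX').
  transitivity (\int[distribution P Y]_z (z ^+ k.*2)%:E)%E; last first.
    by apply: eq_measure_integral => B mB _; exact: lawX.
  rewrite /distribution ge0_integral_pushforward//.
    by apply/measurable_EFinP/measurable_funX.
  by move=> z _; rewrite lee_fin exprn_even_ge0 ?odd_double.
have m2 : (\int[@normal_prob R 0 1]_z (z ^+ 1.*2)%:E <= 1)%E.
  apply: le_trans (normal_moment_le 0) _.
  under eq_integral do rewrite expr0.
  rewrite mul1e integral_cst// mul1e (_ : _ setT = 1%E)//.
  exact: integral_normal_pdf.
have m4 : (\int[@normal_prob R 0 1]_z (z ^+ 2.*2)%:E <= 3%:E)%E.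
  apply: le_trans (normal_moment_le 1) _.
  by rewrite -[leRHS]mule1; apply: lee_wpmul2l => //; rewrite lee_fin.
have m6 : (\int[@normal_prob R 0 1]_z (z ^+ 3.*2)%:E <= 15%:E)%E.
  apply: le_trans (normal_moment_le 2) _.
  have -> : (15%:E = 5%:E * 3%:E :> \bar R)%E by rewrite -EFinM; congr EFin; ring.
  by apply: lee_wpmul2l => //; rewrite lee_fin.
by rewrite (E 1%N) (E 2%N) (E 3%N).
Qed.
End gaussian_moments.

(** * Euclidean inner product and norm *)

Section euclidean.
Context (R : realType) (n : nat).
Implicit Types (x y z : 'rV[R]_n).

Lemma dotv_ge0 x : 0 <= dotv x x.
Proof. by apply: sumr_ge0 => i _; rewrite -expr2 sqr_ge0. Qed.

Lemma enorm_ge0 x : 0 <= enorm x.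
Proof. exact: sqrtr_ge0. Qed.

Lemma sqr_enorm x : enorm x ^+ 2 = dotv x x.
Proof. by rewrite sqr_sqrtr// dotv_ge0. Qed.

Lemma dotvC x y : dotv x y = dotv y x.
Proof. by apply: eq_bigr => i _; rewrite mulrC. Qed.

Lemma dotvZl c x y : dotv (c *: x) y = c * dotv x y.
Proof. by rewrite /dotv mulr_sumr; apply: eq_bigr => i _; rewrite mxE mulrA. Qed.

Lemma dotvZr c x y : dotv x (c *: y) = c * dotv x y.
Proof. by rewrite dotvC dotvZl dotvC. Qed.

Lemma dotvBl x y z : dotv (x - y) z = dotv x z - dotv y z.
Proof.
by rewrite /dotv -sumrB; apply: eq_bigr => i _; rewrite !mxE mulrBl.
Qed.

Lemma dotvBr x y z : dotv x (y - z) = dotv x y - dotv x z.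
Proof. by rewrite dotvC dotvBl !(dotvC x). Qed.

Lemma enormZ c x : enorm (c *: x) = `|c| * enorm x.
Proof.
by rewrite /enorm dotvZl dotvZr mulrA -expr2 sqrtrM ?sqr_ge0// sqrtr_sqr.
Qed.

Lemma enormN x : enorm (- x) = enorm x.
Proof. by rewrite -scaleN1r enormZ normrN1 mul1r. Qed.

Lemma dotv_eq0 x : dotv x x = 0 -> x = 0.
Proof.
move/eqP; rewrite psumr_eq0 => [/allP h|i _]; last by rewrite -expr2 sqr_ge0.
apply/rowP => i; rewrite mxE; have := h i (mem_index_enum _).
by rewrite -expr2 sqrf_eq0 => /eqP.
Qed.

Lemma cauchy_schwarz x y : `|dotv x y| <= enorm x * enorm y.
Proof.
rewrite -(ler_pXn2r (ltn0Sn 1)) ?nnegrE ?mulr_ge0 ?enorm_ge0//.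
rewrite exprMn !sqr_enorm real_normK ?num_real//.
have [y0|y0] := eqVneq (dotv y y) 0.
  have -> : dotv x y = 0.
    by rewrite (dotv_eq0 y0) /dotv big1// => i _; rewrite mxE mulr0.
  by rewrite y0 mulr0 expr2 mulr0.
have {}y0 : 0 < dotv y y by rewrite lt_def y0 dotv_ge0.
(* This vector is [dotv y y] times the component of [x] orthogonal to [y]; its squared length is
   [dotv y y] times the Gram determinant. *)
have := dotv_ge0 (dotv y y *: x - dotv x y *: y).
rewrite dotvBl !dotvBr !dotvZl !dotvZr (dotvC y x) => h.
rewrite -subr_ge0 -(pmulr_rge0 _ y0).
by move: h; congr (0 <= _); ring.
Qed.

(** The factor [n] is cruder than its square root, but it is enough to control approximation by
    rational points. *)
Lemma enorm_le (z : 'rV[R]_n) (e : R) : 0 <= e -> (forall i, `|z 0 i| <= e) ->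
  enorm z <= n%:R * e.
Proof.
move=> e0 h.
rewrite -(ler_pXn2r (ltn0Sn 1)) ?nnegrE ?mulr_ge0 ?enorm_ge0//.
rewrite sqr_enorm; apply: (@le_trans _ _ (\sum_(i < n) e ^+ 2)).
  apply: ler_sum => i _; rewrite -expr2 -real_normK ?num_real//.
  by rewrite lerXn2r ?nnegrE.
rewrite sumr_const card_ord exprMn -[_ ^+ 2 *+ n]mulr_natl ler_wpM2r ?sqr_ge0//.
by rewrite -natrX ler_nat; case: n => // k; rewrite expnS expn1 leq_pmulr.
Qed.
End euclidean.

(** * Measurability of functions of a random vector *)

Lemma measurable_enorm (R : realType) n d (T : measurableType d)
  (v : 'I_n -> T -> R) : (forall i, measurable_fun setT (v i)) ->
  measurable_fun setT (fun w => enorm (\row_i v i w)).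
Proof.
move=> mv; apply: (@measurableT_comp _ _ _ _ _ _ (@Num.sqrt R)).
  by apply: continuous_measurable_fun; exact: sqrt_continuous.
apply: measurable_sum => i.
under eq_fun do rewrite !mxE.
exact: measurable_funM.
Qed.

(* Row vectors carry no Borel structure here, so the preimage of a half-line is
   written as a countable union over the rational points. *)
Lemma measurable_lipschitz (R : realType) n d (T : measurableType d)
  (f : 'rV[R]_n -> R) (L : R) (v : 'I_n -> T -> R) :
  (forall y z, `|f y - f z| <= L * enorm (y - z)) ->
  (forall i, measurable_fun setT (v i)) ->
  measurable_fun setT (fun w => f (\row_i v i w)).
Proof.
move=> fL mv; pose V w := \row_i v i w.
have {}fL y z : f y <= f z + `|L| * enorm (y - z).
  rewrite -lerBlDl; apply: le_trans (ler_norm _) _; apply: le_trans (fL _ _) _.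
  by rewrite ler_wpM2r ?enorm_ge0// ler_norm.
pose rt (q : 'rV[rat]_n) : 'rV[R]_n := map_mx ratr q.
move=> mT; apply: (measurability _ (RGenInftyO.measurableE R)) => // _ [_ [c ->] <-].
have -> : setT `&` (fun w => f (V w)) @^-1` `]-oo, c[ =
  \bigcup_(q : 'rV[rat]_n) [set w | f (rt q) + `|L| * enorm (V w - rt q) < c].
  rewrite setTI; apply/seteqP; split => [w /=|w [q _ /=]]; rewrite in_itv/=;
    last by apply: le_lt_trans; exact: fL.
  (* Moving to the rational point costs [|L| * n * e] twice, once in the value of [f] and once in
     the distance term. This [e] keeps the sum below the margin [c - f (V w)], and the added ones
     keep the denominator positive. *)
  move=> fc; pose e := (c - f (V w)) / (2 * (`|L| + 1) * (n%:R + 1)).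
  have e0 : 0 < e.
    by rewrite divr_gt0 ?subr_gt0// !mulr_gt0// ltr_wpDl.
  have /choice[q qP] : forall i : 'I_n, exists r : rat, `|v i w - ratr r| < e.
    move=> i; have /rat_in_itvoo[r] : v i w - e < v i w + e by lra.
    rewrite in_itv/= => r_in; exists r; rewrite ltr_norml; lra.
  exists (\row_i q i) => //=.
  have qe : enorm (V w - rt (\row_i q i)) <= n%:R * e.
    by apply: enorm_le => [|i]; [exact: ltW|rewrite !mxE ltW].
  have fq := fL (rt (\row_i q i)) (V w).
  rewrite -enormN opprB in fq.
  have lt1 : 2 * `|L| * (n%:R * e) < c - f (V w).
    have -> : c - f (V w) = e * (2 * (`|L| + 1) * (n%:R + 1)).
      by rewrite /e divfK// gt_eqF// !mulr_gt0// ltr_wpDl.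
    rewrite -subr_gt0.
    have -> : e * (2 * (`|L| + 1) * (n%:R + 1)) - 2 * `|L| * (n%:R * e) =
      2 * e * (`|L| + n%:R + 1) by ring.
    have Ln : 0 <= `|L| + n%:R by rewrite addr_ge0.
    by rewrite !mulr_gt0//; lra.
  have le1 : `|L| * enorm (V w - rt (\row_i q i)) <= `|L| * (n%:R * e).
    exact: ler_wpM2l.
  lra.
apply: countable_bigcupT_measurable; first exact: countableP.
move=> q.
have mg : measurable_fun setT (fun w => f (rt q) + `|L| * enorm (V w - rt q)).
  apply: measurable_funD => //; apply: measurable_funM => //.
  rewrite (_ : (fun _ => _) = fun w => enorm (\row_i (v i w - rt q 0 i))).
    by apply: measurable_enorm => i; exact: measurable_funB.
  by apply/funext => w; congr enorm; apply/rowP => i; rewrite !mxE.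
have := mg mT _ (measurable_itv `]-oo, c[).
by rewrite setTI; congr measurable.
Qed.

(** * First-order Taylor bound and size of the gradient *)

Section taylor.
Context (R : realType) (n : nat) (f : 'rV[R]_n -> R).
Implicit Types (x y v : 'rV[R]_n).

Lemma dotv_grad x v : differentiable f x -> dotv (grad f x) v = 'D_v f x.
Proof.
move=> df; rewrite deriveE// [in RHS](row_sum_delta v) linear_sum /dotv.
by apply: eq_bigr => i _; rewrite linearZ /= mxE -deriveE// mulrC.
Qed.

Lemma is_derive_segment x v (t : R) : differentiable f (x + t *: v) ->
  is_derive t 1 (fun s : R => f (x + s *: v)) (dotv (grad f (x + t *: v)) v).
Proof.
move=> df; rewrite dotv_grad//.
have E : (fun h : R => h^-1 *: (f (x + (h *: 1 + t) *: v) - f (x + t *: v))) =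
    (fun h : R => h^-1 *: (f (h *: v + (x + t *: v)) - f (x + t *: v))).
  apply/funext => h; congr (_ *: (f _ - _)).
  by rewrite scalerDl addrCA /GRing.scale/= mulr1.
apply: DeriveDef; first by rewrite /derivable /= E; exact: diff_derivable.
by rewrite /derive /= E.
Qed.

Variable L : R.
Hypothesis df : forall x, differentiable f x.
Hypothesis gradL :
  forall y z, enorm (grad f y - grad f z) <= L * enorm (y - z).

(** Along the segment, the derivative of [f] differs from [D] by at most [2 * c * t]. A monotonicity
    argument turns this into the bound [c] at [t = 1] without integrating the gradient. *)
Lemma taylor_remainder x v :
  `|f (x + v) - f x - dotv (grad f x) v| <= L / 2 * dotv v v.
Proof.
pose D := dotv (grad f x) v; pose c := L / 2 * dotv v v.
have dg (t : R) : is_derive t 1 _ _ := is_derive_segment (df (x + t *: v)).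
have gap (t : R) : 0 <= t ->
    `|dotv (grad f (x + t *: v)) v - D| <= 2 * c * t.
  move=> t0; rewrite -dotvBl; apply: le_trans (cauchy_schwarz _ _) _.
  apply: le_trans (ler_wpM2r (enorm_ge0 _) (gradL _ _)) _.
  rewrite addrAC subrr add0r enormZ ger0_norm// /c -sqr_enorm.
  by rewrite le_eqVlt; apply/orP; left; apply/eqP; field.
have half (s : R) : `|s| = 1 ->
    s * (f (x + v) - f x - D) <= c.
  move=> s1.
  (* The quadratic term makes [p] nonincreasing on the unit interval; [s = 1] and [s = -1] give the
     two halves of the absolute value. *)
  pose p : R -> R := (fun t => s * (f (x + t *: v) - t * D) - c * t ^+ 2).
  have dp (t : R) : is_derive t 1 p
      (s * (dotv (grad f (x + t *: v)) v - D) - 2 * c * t).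
    have := dg t => ?; apply: is_derive_eq.
    by rewrite /GRing.scale/=; ring.
  have cp : continuous p.
    move=> t; apply/differentiable_continuous/derivable1_diffP.
    by have [] := dp t.
  have : p 1 <= p 0.
    apply: (@ler0_derive1_le_cc _ p 0 1) => //=; rewrite ?in_itv/= ?lexx ?ler01//.
    - move=> t; rewrite in_itv/= => /andP[t0 _].
      rewrite derive1E; have [_ ->] := dp t.
      rewrite subr_le0; apply: le_trans _ (gap t (ltW t0)).
      by apply: le_trans (ler_norm _) _; rewrite normrM s1 mul1r.
    - exact: continuous_subspaceT.
  rewrite /p scale1r scale0r addr0 expr1n expr0n /= mulr0 mul0r mulr1 mul1r.
  rewrite !subr0; lra.
rewrite ler_norml; apply/andP; split.
  have := half (-1); rewrite normrN1 => /(_ erefl); rewrite mulN1r -/D -/c; lra.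
by have := half 1; rewrite normr1 mul1r => /(_ erefl).
Qed.

Variable L0 : R.
Hypothesis fL0 : forall y z, `|f y - f z| <= L0 * enorm (y - z).

(** For a small step [t], the Lipschitz bound and the Taylor bound give
    [|D| <= L0 * enorm v + t * c]; the last term is then made arbitrarily small. *)
Lemma dotv_grad_le x v : dotv (grad f x) v ^+ 2 <= L0 ^+ 2 * dotv v v.
Proof.
pose D := dotv (grad f x) v.
suff h : `|D| <= L0 * enorm v.
  rewrite -sqr_enorm -exprMn -/D -(real_normK (num_real D)).
  by rewrite lerXn2r ?nnegrE//; exact: le_trans h.
pose c := `|L / 2 * dotv v v|.
(* With this step [t * c <= e]; the added one covers the case [c = 0]. *)
apply/ler_addgt0Pr => e e0; pose t := e / (c + 1).
have c1 : 0 < c + 1 by rewrite ltr_wpDl// normr_ge0.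
have t0 : 0 < t by rewrite divr_gt0.
have h1 := fL0 (x + t *: v) x.
rewrite (addrAC x) subrr add0r enormZ (gtr0_norm t0) in h1.
have h2 := taylor_remainder x (t *: v).
rewrite !dotvZr dotvZl -/D in h2.
have : t * `|D| <= t * (L0 * enorm v + t * c).
  rewrite -[t in leLHS]gtr0_norm// -normrM.
  have -> : t * D = (f (x + t *: v) - f x) - (f (x + t *: v) - f x - t * D) by ring.
  apply: le_trans (ler_normB _ _) _; rewrite mulrDr lerD//.
    by apply: le_trans h1 _; rewrite mulrCA.
  apply: le_trans h2 _; have -> : L / 2 * (t * (t * dotv v v)) =
    t * (t * (L / 2 * dotv v v)) by ring.
  by rewrite !ler_wpM2l ?ler_norm// ltW.
rewrite ler_pM2l// => h; apply: le_trans h _; rewrite lerD2l.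
rewrite /t -mulrA ler_piMr ?(ltW e0)// mulrC ler_pdivrMr// mul1r lerDl//.
Qed.
End taylor.

(** * Calculus of upper bounds on expectations *)

Section mean_bound.
Context d (Omega : measurableType d) (R : realType) (P : probability Omega R).
Implicit Types (f g : Omega -> R) (A B : R).

(** Measurability and nonnegativity travel with the bound because they are the side conditions of
    linearity and monotonicity for extended integrals. *)
Definition mean_le f A : Prop := [/\ measurable_fun setT f, forall w, 0 <= f w
  & (\int[P]_w (f w)%:E <= A%:E)%E].

Lemma mean_le_cst (c : R) : 0 <= c -> mean_le (fun=> c) c.
Proof.
move=> c0; split => //.
have -> : (\int[P]_w c%:E = c%:E)%E; last by [].
rewrite integral_cst// -[RHS]mule1; congr (_ * _)%E.
exact: probability_setT.
Qed.

Lemma mean_leD f g A B : mean_le f A -> mean_le g B ->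
  mean_le (fun w => f w + g w) (A + B).
Proof.
move=> [mf f0 fA] [mg g0 gB]; split; first exact: measurable_funD.
  by move=> w; rewrite addr_ge0.
under eq_integral do rewrite EFinD.
rewrite ge0_integralD//; last 4 first.
- by move=> w _; rewrite lee_fin.
- exact/measurable_EFinP.
- by move=> w _; rewrite lee_fin.
- exact/measurable_EFinP.
by rewrite EFinD leeD.
Qed.

Lemma mean_leZ (c : R) f A : 0 <= c -> mean_le f A ->
  mean_le (fun w => c * f w) (c * A).
Proof.
move=> c0 [mf f0 fA]; split; first exact: measurable_funM.
  by move=> w; rewrite mulr_ge0.
under eq_integral do rewrite EFinM.
rewrite ge0_integralZl//; last 2 first.
- exact/measurable_EFinP.
- by move=> w _; rewrite lee_fin.
by rewrite EFinM; apply: lee_wpmul2l.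
Qed.

Lemma mean_le_trans f g A B : measurable_fun setT f ->
  (forall w, 0 <= f w <= g w) -> mean_le g A -> A <= B -> mean_le f B.
Proof.
move=> mf fg [mg g0 gA] AB; split => //.
  by move=> w; have /andP[] := fg w.
apply: le_trans (_ : A%:E <= _)%E; last by rewrite lee_fin.
apply: le_trans gA; apply: ge0_le_integral => //.
- by move=> w _; rewrite lee_fin; have /andP[] := fg w.
- exact/measurable_EFinP.
- exact/measurable_EFinP.
- by move=> w _; rewrite lee_fin; have /andP[] := fg w.
Qed.

Lemma mean_le_eq f g A B : mean_le g A -> f =1 g -> A = B -> mean_le f B.
Proof. by move=> gA /funext -> <-. Qed.

Context (I : finType) (X : I -> Omega -> R).
Hypothesis mX : forall i, measurable_fun setT (X i).
Hypothesis indepX : mutually_independent P X.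

(** An upper-bound form of the tower property: [B w] dominates the mean over [X k] with the other
    variables frozen at [w]. *)
Lemma mean_le_freeze k (h : R * g_sigma_algebraType (cylinder X k) -> R)
    (B : Omega -> R) A :
  measurable_fun setT h -> (forall z, 0 <= h z) ->
  (forall w, mean_le (fun v => h (X k v, w)) (B w)) -> mean_le B A ->
  mean_le (fun w => h (X k w, w)) A.
Proof.
move=> mh h0 hB [mB B0 BA]; split => //.
  apply: (measurableT_comp mh); apply: measurable_fun_pair => //.
  by move=> _ C sC; rewrite setTI; exact: (sigma_cylinder_measurable mX sC).
have mhE : measurable_fun setT (EFin \o h) by exact/measurable_EFinP.
rewrite (integral_freeze mX indepX mhE); last by move=> z; rewrite lee_fin.
have mid : measurable_fun setT (id : Omega -> g_sigma_algebraType (cylinder X k)).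
  by move=> _ C sC; rewrite setTI; exact: (sigma_cylinder_measurable mX sC).
pose h' (z : Omega * g_sigma_algebraType (cylinder X k)) := (h (X k z.1, z.2))%:E.
have mh' : measurable_fun setT h'.
  apply: (measurableT_comp mhE); apply: measurable_fun_pair => //.
  exact: measurableT_comp.
have h'0 z : (0 <= h' z)%E by rewrite lee_fin.
apply: le_trans BA; apply: ge0_le_integral => //.
- by move=> w _; apply: integral_ge0 => v _; rewrite lee_fin.
- exact: measurableT_comp
    (measurable_fun_fubini_tonelli_G h' (m1 := P) mh' h'0) mid.
- exact/measurable_EFinP.
- by move=> w _; have [_ _] := hB w.
Qed.

(** These are the chi-square moments. Each induction step freezes all variables but the new [X k]
    and expands a power of [X k w ^+ 2 + T w]. A list of indices allows the induction and selects
    the Gaussian members of a larger family. *)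
Lemma mean_le_sum_sqr (s : seq I) : uniq s ->
  (forall i, i \in s ->
     forall B : set R, measurable B -> P (X i @^-1` B) = normal_prob 0 1 B) ->
  [/\ mean_le (fun w => \sum_(i <- s) X i w ^+ 2) (size s)%:R,
    mean_le (fun w => (\sum_(i <- s) X i w ^+ 2) ^+ 2)
      ((size s)%:R * ((size s)%:R + 2)) &
    mean_le (fun w => (\sum_(i <- s) X i w ^+ 2) ^+ 3)
      ((size s)%:R * ((size s)%:R + 2) * ((size s)%:R + 4))].
Proof.
elim: s => [_ _|k s IH /= /andP[ks us] law].
  by split; apply: (mean_le_eq (mean_le_cst (lexx 0))) => [w|];
    rewrite ?big_nil ?expr0n ?mul0r.
have [|T1 T2 T3] := IH us.
  by move=> i si; apply: law; rewrite inE si orbT.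
have law_k := law k (mem_head _ _).
have [E2 E4 E6] := std_normal_moments (mX k) law_k.
have mXk j : measurable_fun setT (fun w => X k w ^+ j) by exact: measurable_funX.
have M2 : mean_le (fun w => X k w ^+ 2) 1.
  by split=> // w; rewrite exprn_even_ge0.
have M4 : mean_le (fun w => X k w ^+ 4) 3.
  by split=> // w; rewrite exprn_even_ge0.
have M6 : mean_le (fun w => X k w ^+ 6) 15.
  by split=> // w; rewrite exprn_even_ge0.
pose T w := \sum_(i <- s) X i w ^+ 2.
have T0 w : 0 <= T w by apply: sumr_ge0 => i _; rewrite sqr_ge0.
have mT : measurable_fun setT (T : g_sigma_algebraType (cylinder X k) -> R).
  (* The summand at [k] is replaced by zero to make every summand measurable for the coarse
     sigma-algebra; as [k] is not in [s], the sum is unchanged. *)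
  rewrite (_ : T = fun w => \sum_(i <- s) (if i == k then 0 else X i w ^+ 2)).
    apply: measurable_sum => i /=; have [_|ik] := eqVneq i k.
      exact: measurable_cst.
    apply: measurable_funX; exact: measurable_cylinder ik.
  apply/funext => w; apply: eq_big_seq => i si; case: eqP => // ik.
  by rewrite -ik si in ks.
pose h j (z : R * g_sigma_algebraType (cylinder X k)) := (z.1 ^+ 2 + T z.2) ^+ j.
have mh j : measurable_fun setT (h j).
  apply: measurable_funX; apply: measurable_funD.
    by apply: measurable_funX; exact: measurable_fst.
  exact: (measurableT_comp mT measurable_snd).
have h0 j z : 0 <= h j z by rewrite exprn_ge0// addr_ge0// sqr_ge0.
have sT w : \sum_(i <- k :: s) X i w ^+ 2 = X k w ^+ 2 + T w by rewrite big_cons.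
split.
- apply: (mean_le_eq (mean_leD M2 T1)) => [w|]; first exact: sT.
  by rewrite -natr1 addrC.
- have H2 : mean_le (fun w => h 2 (X k w, w))
      ((size s)%:R * ((size s)%:R + 2) + (2 * (size s)%:R + 3)).
    apply: (mean_le_freeze (B := fun w => T w ^+ 2 + (2 * T w + 3))) => //.
      move=> w; apply: (mean_le_eq (mean_leD (mean_le_cst (sqr_ge0 (T w)))
        (mean_leD (mean_leZ (_ : 0 <= 2 * T w) M2) M4))) => [|v|].
      + by rewrite mulr_ge0.
      + by rewrite /h/=; ring.
      + by rewrite mulr1.
    by apply: mean_leD => //; apply: mean_leD; [exact: mean_leZ|exact: mean_le_cst].
  apply: (mean_le_eq H2) => [w|]; first by rewrite sT.
  by rewrite -natr1; ring.
(* Moments 1, 3, 15 of the new coordinate give the conditional bound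
   [T ^+ 3 + 3 * T ^+ 2 + 9 * T + 15]. *)
- have H3 : mean_le (fun w => h 3 (X k w, w))
      ((size s)%:R * ((size s)%:R + 2) * ((size s)%:R + 4) +
       (3 * ((size s)%:R * ((size s)%:R + 2)) + (9 * (size s)%:R + 15))).
    apply: (mean_le_freeze
      (B := fun w => T w ^+ 3 + (3 * T w ^+ 2 + (9 * T w + 15)))) => //.
      move=> w; apply: (mean_le_eq (mean_leD (mean_le_cst (_ : 0 <= T w ^+ 3))
        (mean_leD (mean_leZ (_ : 0 <= 3 * T w ^+ 2) M2)
          (mean_leD (mean_leZ (_ : 0 <= 3 * T w) M4) M6)))) => [|||v|].
      + by rewrite exprn_ge0.
      + by rewrite mulr_ge0// exprn_ge0.
      + by rewrite mulr_ge0.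
      + by rewrite /h/=; ring.
      + by ring.
    apply: mean_leD => //; apply: mean_leD; first exact: mean_leZ.
    by apply: mean_leD; [exact: mean_leZ|exact: mean_le_cst].
  apply: (mean_le_eq H3) => [w|]; first by rewrite sT.
  by rewrite -natr1; ring.
Qed.

(** Mean and variance are prescribed for one copy of the noise; this carries the resulting bounds to
    the other. *)
Lemma mean_le_law (Y Z : Omega -> R) (phi : R -> R) A :
  measurable_fun setT Y -> measurable_fun setT Z ->
  (forall B : set R, measurable B -> P (Y @^-1` B) = P (Z @^-1` B)) ->
  measurable_fun setT phi ->
  mean_le (fun w => phi (Y w)) A -> (forall s, 0 <= phi s) ->
  mean_le (fun w => phi (Z w)) A.
Proof.
move=> mY mZ YZ mphi [_ _ YA] phi0.
pose Ym : {mfun Omega >-> R} := HB.pack Y (isMeasurableFun.Build _ _ _ _ _ mY).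
pose Zm : {mfun Omega >-> R} := HB.pack Z (isMeasurableFun.Build _ _ _ _ _ mZ).
split => //; first exact: measurableT_comp.
have mE : measurable_fun setT (EFin \o phi) by exact/measurable_EFinP.
have push (W : {mfun Omega >-> R}) :
    (\int[P]_w (phi (W w))%:E = \int[distribution P W]_s (phi s)%:E)%E.
  rewrite /distribution ge0_integral_pushforward//.
  by move=> s _; rewrite lee_fin.
rewrite (push Zm); apply: le_trans YA; rewrite (push Ym).
rewrite le_eqVlt; apply/orP; left; apply/eqP.
by apply: eq_measure_integral => B mB _; apply/esym/YZ.
Qed.

(** The cross term vanishes here. It is signed, so [Y] must be integrable, which follows from the
    second moment through [|Y| <= 1 + Y ^+ 2]. *)
Lemma mean_le_affine (Y : Omega -> R) (c e v : R) : measurable_fun setT Y ->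
  (\int[P]_w (Y w)%:E = 0)%E -> (\int[P]_w (Y w ^+ 2)%:E = v%:E)%E ->
  mean_le (fun w => (c + e * Y w) ^+ 2) (c ^+ 2 + e ^+ 2 * v).
Proof.
move=> mY Y0 Y2.
have iY2 : P.-integrable setT (fun w => (Y w ^+ 2)%:E).
  apply/integrableP; split; first exact/measurable_EFinP/measurable_funX.
  under eq_integral do rewrite gee0_abs ?lee_fin ?sqr_ge0//.
  by rewrite Y2 ltry.
have icst (r : R) : P.-integrable setT (fun=> r%:E).
  exact: finite_measure_integrable_cst.
have iY : P.-integrable setT (fun w => (Y w)%:E).
  apply: (@le_integrable _ _ _ P setT _ _
    (fun w => 1%:E + (Y w ^+ 2)%:E)%E) => //.
  - exact/measurable_EFinP.
  - move=> w _; rewrite -EFinD /= lee_fin [leRHS]ger0_norm ?addr_ge0 ?sqr_ge0//.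
    rewrite -(real_normK (num_real (Y w))).
    by have := sqr_ge0 (`|Y w| - 2^-1); rewrite -subr_ge0; nra.
  - exact: integrableD.
split; [|by move=> w; rewrite sqr_ge0|].
  by apply: measurable_funX; apply: measurable_funD => //; exact: measurable_funM.
under eq_integral.
  move=> w _.
  rewrite (_ : (_ ^+ 2)%:E = (c ^+ 2)%:E + ((2 * c * e)%:E * (Y w)%:E +
    (e ^+ 2)%:E * (Y w ^+ 2)%:E))%E; last first.
    by rewrite -!EFinM -!EFinD; congr EFin; ring.
  over.
have i1 : P.-integrable setT (fun w => (2 * c * e)%:E * (Y w)%:E)%E.
  exact: integrableZl.
have i2 : P.-integrable setT (fun w => (e ^+ 2)%:E * (Y w ^+ 2)%:E)%E.
  exact: integrableZl.
rewrite integralD//; last exact: integrableD.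
rewrite integralD// !integralZl// Y0 Y2 mule0 add0e.
have [_ _ h] := mean_le_cst (sqr_ge0 c).
by rewrite EFinD EFinM leeD2r.
Qed.
End mean_bound.

(** * The error as a function of the noise, and its deterministic bound *)

Lemma expectation_variance_moments d (Omega : measurableType d) (R : realType)
  (P : probability Omega R) (Y : {RV P >-> R}) (v : R) :
  ('E_P[Y] = 0)%E -> ('V_P[Y] = v%:E)%E ->
  (\int[P]_w (Y w)%:E = 0)%E /\ (\int[P]_w (Y w ^+ 2)%:E = v%:E)%E.
Proof.
move=> EY VY; split; first by rewrite -EY unlock.
rewrite -VY /variance covariance.unlock EY unlock.
by apply: eq_integral => w _; congr EFin; rewrite /= !fctE /= subr0 expr2.
Qed.

(** The grouping shows a square that is affine in [s], with a constant part affine in [t], ready for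
    the two successive averages. *)
Lemma errE (R : realType) n (f : 'rV[R]_n -> R) (x u : 'rV[R]_n) (mu s t : R) :
  let F := f (x + mu *: u) in
  err f x mu u s t = dotv u u *
    (((F - f x) / mu - dotv (grad f x) u - f x / mu * t) + F / mu * s) ^+ 2.
Proof.
rewrite /err -scalerBl sqr_enorm dotvZl dotvZr mulrA -expr2 mulrC /noisy /=.
by congr (_ * _ ^+ 2); ring.
Qed.

Lemma err_mean_bound_le (R : realType) (S r g D F mu L0 L1 v : R) :
  0 <= S -> 0 <= v -> mu != 0 ->
  F = g + mu * D + mu * r -> `|r| <= L1 * mu / 2 * S -> D ^+ 2 <= L0 ^+ 2 * S ->
  S * (r ^+ 2 + (g / mu) ^+ 2 * v + (F / mu) ^+ 2 * v) <=
  (1 + 3 * v) * L1 ^+ 2 * mu ^+ 2 / 4 * S ^+ 3 + 3 * L0 ^+ 2 * v * S ^+ 2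
    + 4 * v * g ^+ 2 / mu ^+ 2 * S.
Proof.
move=> S0 v0 mu0 FE r_le D_le.
have r2 : r ^+ 2 <= (L1 * mu / 2 * S) ^+ 2.
  rewrite -(real_normK (num_real r)) lerXn2r ?nnegrE//.
  exact: le_trans r_le.
(* The square of a sum of three terms is at most three times the sum of squares; this produces the
   factors [1 + 3 * v] and [4 * v = v + 3 * v]. *)
have F2 : (F / mu) ^+ 2 <= 3 * (g / mu) ^+ 2 + 3 * D ^+ 2 + 3 * r ^+ 2.
  have -> : F / mu = g / mu + D + r by rewrite FE; field.
  have := sqr_ge0 (g / mu - D); have := sqr_ge0 (g / mu - r).
  have := sqr_ge0 (D - r); nra.
apply: (@le_trans _ _ (S * ((1 + 3 * v) * r ^+ 2 + 4 * v * (g / mu) ^+ 2 +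
    3 * v * D ^+ 2))).
  apply: ler_wpM2l => //; have := ler_wpM2r v0 F2; lra.
apply: (@le_trans _ _ (S * ((1 + 3 * v) * (L1 * mu / 2 * S) ^+ 2 +
    4 * v * (g / mu) ^+ 2 + 3 * v * (L0 ^+ 2 * S)))).
  apply: ler_wpM2l => //; apply: lerD; first apply: lerD => //.
    by apply: ler_wpM2l => //; lra.
  by apply: ler_wpM2l => //; lra.
by rewrite le_eqVlt; apply/orP; left; apply/eqP; field.
Qed.

(** * The step-size constant *)

Lemma C4_gt0 (R : realType) n (L1 sr : R) : (0 < n)%N -> 0 < L1 -> 0 < sr ->
  0 < C4 n L1 sr.
Proof.
move=> n0 L10 sr0; apply: powR_gt0.
have n1 : 0 < n%:R :> R by rewrite ltr0n.
by rewrite divr_gt0// !mulr_gt0// ?exprn_gt0// addr_gt0// mulr_gt0// exprn_gt0.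
Qed.

(* [C4] is chosen so that the two terms on the left are equal. *)
Lemma C4_balance (R : realType) n (L1 sr : R) (m := C4 n L1 sr ^+ 2) :
  (0 < n)%N -> 0 < L1 -> 0 < sr ->
  (1 + 3 * sr ^+ 2) * L1 ^+ 2 * m / 4 * (n%:R + 6) ^+ 3 +
    4 * sr ^+ 2 / m * n%:R =
  2 * L1 * sr * Num.sqrt ((1 + 3 * sr ^+ 2) * n%:R * (n%:R + 6) ^+ 3).
Proof.
move=> n0 L10 sr0.
have n1 : 0 < n%:R :> R by rewrite ltr0n.
have b0 : 0 < 1 + 3 * sr ^+ 2 by rewrite addr_gt0// mulr_gt0// exprn_gt0.
have c0 : 0 < (n%:R + 6) ^+ 3 :> R by rewrite exprn_gt0// addr_gt0.
set A := (1 + 3 * sr ^+ 2) * n%:R * (n%:R + 6) ^+ 3; set q := Num.sqrt A.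
have A0 : 0 < A by rewrite !mulr_gt0.
have q0 : 0 < q by rewrite sqrtr_gt0.
have q2 : q ^+ 2 = A by rewrite sqr_sqrtr// ltW.
have m0 : 0 < m by rewrite exprn_gt0// C4_gt0.
(* Squaring both sides removes the fourth root. With this closed form each of the two terms equals
   [L1 * sr * q]. *)
have mE : m = 4 * sr * n%:R / (L1 * q).
  apply: (pexpIrn (isT : (0 < 2)%N)); rewrite ?nnegrE ?ltW//.
    by rewrite divr_gt0 ?mulr_gt0.
  rewrite /m -exprM -powR_mulrn ?powR_ge0// -powRrM mulVf// powRr1; last first.
    by rewrite ltW// divr_gt0// !mulr_gt0// ?exprn_gt0.
  rewrite !exprMn exprVn exprMn q2 /A; field.
  by rewrite !gt_eqF.
have -> : (1 + 3 * sr ^+ 2) * L1 ^+ 2 * m / 4 * (n%:R + 6) ^+ 3 =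
    q ^+ 2 * L1 ^+ 2 * m / (4 * n%:R).
  by rewrite q2 /A; field; rewrite gt_eqF.
rewrite mE; field.
by rewrite !gt_eqF.
Qed.

(** * Assembling the bound *)

Theorem theorem3 (R : realType) (n : nat) (f : 'rV[R]_n -> R) (L0 L1 : R)
  (d : measure_display) (Omega : measurableType d) (P : probability Omega R)
  (u : 'I_n -> {RV P >-> R}) (nu1 nu2 : {RV P >-> R}) (sr a b : R)
  (x : 'rV[R]_n) :
  convex_fun f -> C1_fun f ->
  (forall y z : 'rV[R]_n, `|f y - f z| <= L0 * enorm (y - z)) ->
  (forall y z : 'rV[R]_n, enorm (grad f y - grad f z) <= L1 * enorm (y - z)) ->
  0 < L1 ->
  (* u = (u_1,...,u_n) standard Gaussian, and u, nu1, nu2 mutually independent *)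
  (forall i (B : set R), measurable B -> P (u i @^-1` B) = normal_prob 0 1 B) ->
  mutually_independent P
    (fun k : 'I_n + bool => match k with
       | inl i => (u i : Omega -> R)
       | inr true => (nu1 : Omega -> R)
       | inr false => (nu2 : Omega -> R) end) ->
  (* nu1, nu2 are copies of the noise nu *)
  (forall B : set R, measurable B -> P (nu1 @^-1` B) = P (nu2 @^-1` B)) ->
  ('E_P[nu1] = 0)%E ->
  0 < sr -> ('V_P[nu1] = (sr ^+ 2)%:E)%E ->
  (\int[P]_w ((1 + nu1 w)^-1)%:E <= b%:E)%E ->
  a < 1 -> P (nu1 @^-1` `[- a, a]) = 1%E ->
  f x != 0 ->
  let mustar := C4 n L1 sr * Num.sqrt `|f x| in
  (\int[P]_w (err f x mustar (\row_i u i w) (nu1 w) (nu2 w))%:E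
    <= (2 * L1 * sr * Num.sqrt ((1 + 3 * sr ^+ 2) * n%:R * (n%:R + 6) ^+ 3)
          * `|f x| + 3 * L0 ^+ 2 * sr ^+ 2 * (n%:R + 4) ^+ 2)%:E)%E.
Proof.
move=> _ [df _] fL gradL L10 law indep nu12 E1 sr0 V1 _ _ _ gx0; cbv zeta.
set mu := C4 n L1 sr * Num.sqrt `|f x|.
have [Y1 Y2] := expectation_variance_moments E1 V1.
(* In dimension zero [C4] and hence [mu] vanish, so division by [mu] is meaningless; there the error
   is zero because [u] is the empty vector. *)
case: (posnP n) => [n0|n0].
  rewrite (_ : (\int[P]_w _)%E = 0%E); last first.
    apply: integral0_eq => w _; rewrite errE /dotv big1 ?mul0r// => i _.
    by have := ltn_ord i; rewrite {2}n0.
  rewrite lee_fin addr_ge0//; last first.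
    by rewrite mulr_ge0 ?sqr_ge0// mulr_ge0 ?sqr_ge0// mulr_ge0 ?sqr_ge0.
  by rewrite !mulr_ge0 ?sqrtr_ge0// ltW.
set X := (fun k : 'I_n + bool => _) in indep.
have mX k : measurable_fun setT (X k) by case: k => [i|[]].
pose g := f x; pose v := sr ^+ 2.
pose S w := \sum_(i < n) u i w ^+ 2.
pose F w := f (x + mu *: \row_i u i w).
pose D w := dotv (grad f x) (\row_i u i w).
pose r w := (F w - g) / mu - D w.
have v0 : 0 <= v by exact: sqr_ge0.
have mu0 : 0 < mu.
  by apply: mulr_gt0; [exact: C4_gt0|rewrite sqrtr_gt0 normr_gt0].
have dotS w : dotv (\row_i u i w) (\row_i u i w) = S w.
  by apply: eq_bigr => i _; rewrite !mxE expr2.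
have S0 w : 0 <= S w by rewrite -dotS dotv_ge0.
(* The Boolean [c] names the noise value being integrated out; functions of [u] alone must be
   measurable for both coarse sigma-algebras. *)
have mU c i : measurable_fun setT
    (u i : g_sigma_algebraType (cylinder X (inr c)) -> R).
  exact: (measurable_cylinder (X := X) (k := inr c) (i := inl i)).
have mS c : measurable_fun setT
    (S : g_sigma_algebraType (cylinder X (inr c)) -> R).
  by apply: measurable_sum => i; apply: measurable_funX; exact: mU.
have mF c : measurable_fun setT
    (F : g_sigma_algebraType (cylinder X (inr c)) -> R).
  rewrite (_ : F = fun w => f (\row_i (x 0 i + mu * u i w))).
    apply: (measurable_lipschitz fL) => i; apply: measurable_funD => //.
    by apply: measurable_funM => //; exact: mU.
  by apply/funext => w; congr f; apply/rowP => i; rewrite !mxE.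
have mr c : measurable_fun setT
    (r : g_sigma_algebraType (cylinder X (inr c)) -> R).
  apply: measurable_funB.
    by apply: measurable_funM => //; apply: measurable_funB => //; exact: mF.
  apply: measurable_sum => i; apply: measurable_funM => //.
  by under eq_fun do rewrite mxE; exact: mU.
(* [B1] is what remains after averaging over [nu1], [B2] after averaging over [nu2] as well, and [Q]
   is the polynomial in [S] dominating [B2]. The bound [A] is established in the reverse order, from
   [Q] outwards. *)
pose Q w := (1 + 3 * v) * L1 ^+ 2 * mu ^+ 2 / 4 * S w ^+ 3 +
  3 * L0 ^+ 2 * v * S w ^+ 2 + 4 * v * g ^+ 2 / mu ^+ 2 * S w.
pose B2 w := S w * (r w ^+ 2 + (g / mu) ^+ 2 * v) + S w * (F w / mu) ^+ 2 * v.
pose B1 w := S w * (r w - g / mu * nu2 w) ^+ 2 + S w * (F w / mu) ^+ 2 * v.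
pose A := 2 * L1 * sr * Num.sqrt ((1 + 3 * sr ^+ 2) * n%:R * (n%:R + 6) ^+ 3)
  * `|f x| + 3 * L0 ^+ 2 * sr ^+ 2 * (n%:R + 4) ^+ 2.
have lift c (h : Omega -> R) :
    measurable_fun setT (h : g_sigma_algebraType (cylinder X (inr c)) -> R) ->
    measurable_fun setT h.
  move=> mh _ C mC; apply: (sigma_cylinder_measurable mX (k := inr c)).
  exact: mh.
have QA : mean_le P Q A.
  have sumS w : \sum_(i <- [seq inl i | i <- enum 'I_n]) X i w ^+ 2 = S w.
    by rewrite big_map big_enum.
  have [||S1 S2 S3] := mean_le_sum_sqr mX indep
    (s := [seq inl i | i <- enum 'I_n]).
  - by rewrite map_inj_uniq ?enum_uniq// => i j [].
  - by move=> _ /mapP[i _ ->]; exact: law.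
  rewrite size_map size_enum_ord in S1 S2 S3.
  have c3 : 0 <= (1 + 3 * v) * L1 ^+ 2 * mu ^+ 2 / 4.
    rewrite mulr_ge0 ?invr_ge0// mulr_ge0 ?sqr_ge0// mulr_ge0 ?sqr_ge0//.
    by rewrite addr_ge0// mulr_ge0.
  have c2 : 0 <= 3 * L0 ^+ 2 * v by rewrite mulr_ge0// mulr_ge0 ?sqr_ge0.
  have c1 : 0 <= 4 * v * g ^+ 2 / mu ^+ 2.
    by rewrite mulr_ge0 ?invr_ge0 ?sqr_ge0// mulr_ge0 ?sqr_ge0// mulr_ge0.
  have mQ : measurable_fun setT Q.
    apply: (@lift true); apply: measurable_funD; last exact: measurable_funM.
    by apply: measurable_funD; apply: measurable_funM => //; exact: measurable_funX.
  have n1 : 0 <= n%:R :> R by [].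
  have Q0 w : 0 <= Q w by rewrite !addr_ge0// mulr_ge0// exprn_ge0.
  apply: (mean_le_trans mQ _ (mean_leD (mean_leD (mean_leZ c3 S3)
    (mean_leZ c2 S2)) (mean_leZ c1 S1))) => [w|].
    by rewrite Q0 /= !sumS.
  have mu2 : mu ^+ 2 = C4 n L1 sr ^+ 2 * `|g| by rewrite exprMn sqr_sqrtr.
  have bal := C4_balance n0 L10 sr0.
  have m0 : 0 < C4 n L1 sr ^+ 2 by rewrite exprn_gt0// C4_gt0.
  have g0 : 0 < `|g| by rewrite normr_gt0.
  have gg : g ^+ 2 = `|g| ^+ 2 by rewrite real_normK ?num_real.
  (* The moment bounds are relaxed to the constants of the statement:
     [n (n + 2) (n + 4) <= (n + 6) ^+ 3] and [n (n + 2) <= (n + 4) ^+ 2]. *)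
  apply: (@le_trans _ _ ((1 + 3 * v) * L1 ^+ 2 * mu ^+ 2 / 4 * (n%:R + 6) ^+ 3 +
    3 * L0 ^+ 2 * v * (n%:R + 4) ^+ 2 + 4 * v * g ^+ 2 / mu ^+ 2 * n%:R)).
    by rewrite lerD2r lerD// ler_wpM2l//; nra.
  rewrite /A -bal mu2 gg -/v.
  rewrite le_eqVlt; apply/orP; left; apply/eqP; field.
  by rewrite !gt_eqF// C4_gt0.
have B2A : mean_le P B2 A.
  apply: (mean_le_trans _ _ QA (lexx _)).
    apply: (@lift true); apply: measurable_funD.
      apply: measurable_funM; first exact: mS.
      by apply: measurable_funD => //; apply: measurable_funX; exact: mr.
    apply: measurable_funM => //; apply: measurable_funM; first exact: mS.
    by apply: measurable_funX; apply: measurable_funM => //; exact: mF.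
  move=> w; rewrite /B2 -mulrA -mulrDr; apply/andP; split.
    have v2 (s : R) : 0 <= s ^+ 2 * v by rewrite mulr_ge0 ?sqr_ge0.
    by rewrite mulr_ge0// !addr_ge0 ?v2 ?sqr_ge0.
  apply: (err_mean_bound_le (r := r w) (D := D w)) => //.
  - by rewrite gt_eqF.
  - by rewrite /r; field; rewrite gt_eqF.
  - have := taylor_remainder df gradL x (mu *: \row_i u i w).
    rewrite !dotvZr dotvZl dotS -/(F w) -/g -/(D w) => h.
    (* Multiplied by [mu], the scaled remainder [r] is the Taylor remainder for the displacement
       [mu *: u]. *)
    rewrite -(ler_pM2l mu0) -[X in X * _ <= _](gtr0_norm mu0) -normrM.
    rewrite (_ : mu * r w = F w - g - mu * D w); last first.
      by rewrite /r; field; rewrite gt_eqF.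
    apply: le_trans h _.
    by rewrite le_eqVlt; apply/orP; left; apply/eqP; field.
  - by rewrite -dotS; exact: (dotv_grad_le df gradL).
have B1A : mean_le P B1 A.
  pose h (z : R * g_sigma_algebraType (cylinder X (inr false))) :=
    S z.2 * (r z.2 + - (g / mu) * z.1) ^+ 2 + S z.2 * (F z.2 / mu) ^+ 2 * v.
  have m2 (k : Omega -> R) :
      measurable_fun setT (k : g_sigma_algebraType (cylinder X (inr false)) -> R) ->
      measurable_fun setT (fun z : R * g_sigma_algebraType (cylinder X (inr false))
        => k z.2).
    by move=> mk; exact: (measurableT_comp mk measurable_snd).
  have H : mean_le P (fun w => h (X (inr false) w, w)) A.
    apply: (mean_le_freeze mX indep _ _ _ B2A).
    - apply: measurable_funD.
        apply: measurable_funM; first exact: (m2 _ (mS _)).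
        apply: measurable_funX; apply: measurable_funD; first exact: (m2 _ (mr _)).
        by apply: measurable_funM => //; exact: measurable_fst.
      apply: measurable_funM => //; apply: measurable_funM; first exact: (m2 _ (mS _)).
      by apply: measurable_funX; apply: measurable_funM => //; exact: (m2 _ (mF _)).
    - move=> z; rewrite addr_ge0// mulr_ge0 ?sqr_ge0//.
      by rewrite mulr_ge0 ?sqr_ge0.
    - move=> w; rewrite /h /B2 /=.
      apply: mean_leD; last first.
        by apply: mean_le_cst; rewrite mulr_ge0// mulr_ge0 ?sqr_ge0.
      apply: mean_leZ => //; rewrite -(sqrrN (g / mu)).
      (* The average is computed for [nu1], whose moments are known, and transferred to [nu2]. *)
      apply: (mean_le_law (Y := nu1) (Z := nu2)
        (phi := fun s => (r w + - (g / mu) * s) ^+ 2)) => //.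
      + by apply: measurable_funX; apply: measurable_funD.
      + exact: mean_le_affine.
      + by move=> s; rewrite sqr_ge0.
  by apply: (mean_le_eq H) => // w; rewrite /B1 /h /= mulNr.
pose h (z : R * g_sigma_algebraType (cylinder X (inr true))) :=
  S z.2 * ((r z.2 - g / mu * nu2 z.2) + F z.2 / mu * z.1) ^+ 2.
have m2 (k : Omega -> R) :
    measurable_fun setT (k : g_sigma_algebraType (cylinder X (inr true)) -> R) ->
    measurable_fun setT (fun z : R * g_sigma_algebraType (cylinder X (inr true))
      => k z.2).
  by move=> mk; exact: (measurableT_comp mk measurable_snd).
have mnu2 : measurable_fun setT
    (nu2 : g_sigma_algebraType (cylinder X (inr true)) -> R).
  exact: (measurable_cylinder (X := X) (k := inr true) (i := inr false)).
have [_ _] : mean_le P (fun w => h (X (inr true) w, w)) A.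
  apply: (mean_le_freeze mX indep _ _ _ B1A).
  - apply: measurable_funM; first exact: (m2 _ (mS _)).
    apply: measurable_funX; apply: measurable_funD.
      apply: measurable_funB; first exact: (m2 _ (mr _)).
      by apply: measurable_funM => //; exact: (m2 _ mnu2).
    apply: measurable_funM; last exact: measurable_fst.
    by apply: measurable_funM => //; exact: (m2 _ (mF _)).
  - by move=> z; rewrite mulr_ge0 ?sqr_ge0.
  - move=> w; rewrite /h /B1 /=.
    rewrite -[S w * _ * v]mulrA -mulrDr.
    by apply: mean_leZ => //; exact: mean_le_affine.
apply: le_trans; rewrite le_eqVlt; apply/orP; left; apply/eqP.
by apply: eq_integral => w _; rewrite errE dotS.
Qed.
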